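(* Let $f$ be an exponential family kernel with sufficient statistic of dimension $q\in\mathbb N$, i.e. $$f(x\mid\theta)=h(x)\exp\Big\{\sum_{i=1}^q\eta_i(\theta)T_i(x)-A(\theta)\Big\},\qquad x\in\mathcal X,\ \theta\in\Theta,$$ with $h$ measurable, $T=(T_1,\ldots,T_q):\mathcal X\to\mathbb R^q$, $\eta=(\eta_1,\ldots,\eta_q):\Theta\to\mathbb R^q$ and $A:\Theta\to\mathbb R$. Suppose that $h>0$ $\lambda$-almost everywhere, that $A$ is continuous on the compact parameter space $\Theta$, that $T$ is continuous on $\mathcal X$, and that $\eta$ is injective and continuous (hence a homeomorphism onto its image $\eta(\Theta)$). If $T(\mathcal X)$ is determining for $\exp\{\eta(\Theta)\}$, where the exponential is applied coordinate-wise, then the mixture operator $\mathcal A$ is injective on $\mathcal M(\Theta)$; that is, if $G\in\mathcal M(\Theta)$ and $\mathcal AG=0$ $\lambda$-almost everywhere, then $G=0$.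
   Context: Standing setting. The sample space $\mathcal X$ is a Borel subset of $\mathbb R^{d_1}$ with a $\sigma$-finite Borel measure $\lambda$, understood to be Lebesgue measure for continuous kernels and counting measure for discrete ones. The parameter space $\Theta\subset\mathbb R^{d_2}$ is compact and equal to the closure of its interior $\Theta^\circ$, which is non-empty. A kernel is a jointly measurable function $f:\mathcal X\times\Theta\to[0,\infty)$, written $f(x\mid\theta)$, with $\int_{\mathcal X}f(x\mid\theta)\,\lambda(dx)=1$ for every $\theta\in\Theta$. (In the paper's definition of an exponential family $h$ takes values in $(0,\infty)$.) $\mathcal M(\Theta)$ is the Banach space of finite signed Radon measures on $\Theta$. The mixture operator $\mathcal A:\mathcal M(\Theta)\to L^1(\mathcal X,\lambda)$ is $(\mathcal AG)(x):=\int_\Theta f(x\mid\theta)\,G(d\theta)$. Determining sets. Let $\Omega\subset(0,\infty)^q$ be compact. A set $S\subseteq\mathbb R^q$ is determining for $\Omega$ if the linear span of $\{y\mapsto y^s:s\in S\}$, where $y^s:=y_1^{s_1}\cdots y_q^{s_q}$ for $y\in(0,\infty)^q$, is dense in the space $C(\Omega)$ of continuous real functions on $\Omega$ with the supremum norm.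
   Formalization: Adds that every nonempty relatively open subset of the sample space has positive λ-measure; without it the claim fails, e.g. Lebesgue on [0,1]∪{2,3,…}, Θ=[0,1], h=1, A=0, η=id, T=0 on [0,1], T(n)=n−1, G=δ₀−δ₁. *)

(* Defs.v *)
From HB Require Import structures.
From mathcomp Require Import all_boot all_order all_algebra.
From mathcomp Require Import all_classical all_reals all_analysis.

Set Implicit Arguments.
Unset Strict Implicit.
Unset Printing Implicit Defensive.

Import Order.TTheory GRing.Theory Num.Theory.
Import numFieldNormedType.Exports.

Local Open Scope classical_set_scope.
Local Open Scope ring_scope.

(* R^n with its Borel sigma-algebra; the carrier is 'rV[R]_n itself, so sets
   and functions on 'rV[R]_n can be used on either side. *)
Notation borel_rV R n := (g_sigma_algebraType (@open 'rV[R]_n)).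

(* Integral against a finite signed measure: difference of the integrals
   against the two parts of the Jordan decomposition.  By charge_integralE the
   Hahn decomposition picked here is irrelevant. *)
Definition charge_integral d (T : measurableType d) (R : realType)
    (nu : {charge set T -> \bar R}) (D : set T) (g : T -> \bar R) : \bar R :=
  let hP := cid (Hahn_decomposition nu) in
  let hN := cid (svalP hP) in
  (\int[jordan_pos (svalP hN)]_(x in D) g x
   - \int[jordan_neg (svalP hN)]_(x in D) g x)%E.

Lemma charge_integralE d (T : measurableType d) (R : realType)
    (nu : {charge set T -> \bar R}) (P N : set T)
    (nuPN : hahn_decomposition nu P N) (D : set T) (g : T -> \bar R) :
  charge_integral nu D g =
  (\int[jordan_pos nuPN]_(x in D) g x - \int[jordan_neg nuPN]_(x in D) g x)%E.
Proof.
rewrite /charge_integral /=.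
move: (svalP (cid (svalP (cid (Hahn_decomposition nu))))) => h.
congr (_ - _)%E; apply: eq_measure_integral => A mA _.
- have [eqP _] := Hahn_decomposition_uniq h nuPN mA.
  rewrite [LHS]jordan_posE [RHS]jordan_posE !cjordan_posE /crestr0.
  by rewrite mem_set.
- have [_ eqN] := Hahn_decomposition_uniq h nuPN mA.
  rewrite [LHS]jordan_negE [RHS]jordan_negE !cjordan_negE /crestr0.
  by rewrite mem_set// /crestr eqN.
Qed.

(* M(Theta): finite signed Borel measures on Theta, represented as charges on
   R^n that vanish off Theta (for Theta compact in R^n every finite Borel
   measure is Radon). *)
Definition signed_measure_on (R : realType) (n : nat) (Theta : set 'rV[R]_n)
    (G : {charge set (borel_rV R n) -> \bar R}) : Prop :=
  forall B : set (borel_rV R n), measurable B -> B `&` Theta = set0 ->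
    G B = 0%E.

Definition parameter_space (R : realType) (n : nat) (Theta : set 'rV[R]_n) :=
  [/\ compact Theta, interior Theta !=set0
    & closure (interior Theta) = Theta].

Definition is_kernel (R : realType) (d1 d2 : nat) (X : set 'rV[R]_d1)
    (lam : {measure set (borel_rV R d1) -> \bar R}) (Theta : set 'rV[R]_d2)
    (f : 'rV[R]_d1 -> 'rV[R]_d2 -> R) : Prop :=
  [/\ forall x theta, X x -> Theta theta -> 0 <= f x theta,
      measurable_fun (X `*` Theta : set (borel_rV R d1 * borel_rV R d2))
        (fun z : borel_rV R d1 * borel_rV R d2 => f z.1 z.2)
    & forall theta, Theta theta -> (\int[lam]_(x in X) (f x theta)%:E = 1)%E].

Definition exponential_form (R : realType) (d1 d2 q : nat)
    (X : set 'rV[R]_d1) (Theta : set 'rV[R]_d2)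
    (f : 'rV[R]_d1 -> 'rV[R]_d2 -> R)
    (h : 'rV[R]_d1 -> R) (T : 'rV[R]_d1 -> 'rV[R]_q)
    (eta : 'rV[R]_d2 -> 'rV[R]_q) (A : 'rV[R]_d2 -> R) : Prop :=
  forall x theta, X x -> Theta theta ->
    f x theta = h x * expR ((\sum_(i < q) eta theta 0 i * T x 0 i) - A theta).

(* Every nonempty relatively open subset of X has positive measure.  Counting
   measure on X always has this property; Lebesgue measure has it as soon as
   X has no nonempty relatively open null part.  Without it an almost
   everywhere identity says nothing about the isolated null points of X, which
   nevertheless contribute to T @` X. *)
Definition full_support (R : realType) (n : nat) (X : set 'rV[R]_n)
    (lam : {measure set (borel_rV R n) -> \bar R}) : Prop :=
  forall U : set 'rV[R]_n, open U -> X `&` U !=set0 -> (0 < lam (X `&` U))%E.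

(* The value is extended-real; +oo - oo and infinite values can only occur on a
   lam-null set of x, where A G is not defined as an element of L^1. *)
Definition mixture (R : realType) (d1 d2 : nat) (Theta : set 'rV[R]_d2)
    (f : 'rV[R]_d1 -> 'rV[R]_d2 -> R)
    (G : {charge set (borel_rV R d2) -> \bar R}) (x : 'rV[R]_d1) : \bar R :=
  charge_integral G Theta (fun theta => (f x theta)%:E).

Definition rV_powR (R : realType) (q : nat) (y s : 'rV[R]_q) : R :=
  \prod_(i < q) y 0 i `^ s 0 i.

Definition power_span (R : realType) (q : nat) (S : set 'rV[R]_q) :
    set ('rV[R]_q -> R) :=
  [set p | exists (n : nat) (c : 'I_n -> R) (s : 'I_n -> 'rV[R]_q),
     (forall k, S (s k)) /\ p = (fun y => \sum_(k < n) c k * rV_powR y (s k))].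

(* Density in C(Omega) for the supremum norm on Omega; elements of C(Omega) are
   represented by arbitrary extensions to R^q. *)
Definition determining (R : realType) (q : nat) (Omega S : set 'rV[R]_q) :=
  [set g : 'rV[R]_q -> R | {within Omega, continuous g}] `<=`
  closure (power_span S : set {uniform` Omega -> R}).

Lemma determiningP (R : realType) (q : nat) (Omega S : set 'rV[R]_q) :
  determining Omega S <->
  forall g : 'rV[R]_q -> R, {within Omega, continuous g} ->
  forall e : R, 0 < e -> exists2 p, power_span S p &
    forall y, Omega y -> `|g y - p y| < e.
Proof.
split=> [dS g cg e e0|dS g cg B].
- have [] := dS g cg [set p | forall y, Omega y -> `|g y - p y| < e].
    apply/uniform_nbhs; exists [set z | ball z.1 e z.2].
    by split; [exact: entourage_ball (PosNum e0)|].
  by move=> p [Sp pe]; exists p.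
- move=> /uniform_nbhs[E []]; rewrite -entourage_ballE => -[e /= e0 eE] EB.
  have [p Sp pe] := dS g cg e e0.
  by exists p; split=> //; apply: EB => y Oy; apply: eE; exact: pe.
Qed.

(* Main.v *)
Require Import Defs.
From HB Require Import structures.
From mathcomp Require Import all_boot all_order all_algebra.
From mathcomp Require Import all_classical all_reals all_analysis.
From mathcomp Require Import measurable_realfun.
Set Implicit Arguments.
Unset Strict Implicit.

Import Order.TTheory GRing.Theory Num.Theory.
Import numFieldNormedType.Exports.
Local Open Scope classical_set_scope.
Local Open Scope ring_scope.

(** Let [mu - nu] be the Jordan decomposition of [G].  Where [h x > 0], the
    equation [mixture Theta f G x = 0] says that [mu] and [nu] give the same
    integral to [y |-> y^(T x)] composed with [theta |-> exp (eta theta)] and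
    multiplied by the weight [expR (- A theta)].  The proof enlarges, in four
    stages, the class of bounded functions on [Theta] to which [mu] and [nu] give
    the same integral ([balanced]), a class which is a vector space closed under
    bounded pointwise limits ([balanced_lim]).

    The functions above lie in the class for almost every [x] in [X].  As [lam]
    has full support these [x] are dense in [X], so the continuity of [T] gives
    all powers [y^s] with [s] in [T @` X] ([balanced_tilt_closed]).  The
    determining property then gives every continuous function of
    [exp (eta theta)] times the weight ([balanced_continuous]).  For a closed set
    [K], the image of [Theta `&` K] under [exp \o eta] is compact, hence its
    indicator is a bounded limit of continuous functions; since [exp \o eta] is
    injective, that indicator pulls back to the indicator of [K] on [Theta]
    ([balanced_closed]).  Finally a Dynkin-class argument gives all Borel sets
    ([balanced_borel]).

    Applied to the positive set [P] of a Hahn decomposition, where [nu] vanishes,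
    this shows that the integral of the weight over [Theta `&` P] for [mu] is
    zero.  The weight is positive, so [mu] vanishes, and by symmetry so does
    [nu] ([balanced_singular]). *)

(** * Bounded functions with equal integrals for two measures *)

Section balanced.
Context d (T : measurableType d) (R : realType).
Variables (mu nu : {finite_measure set T -> \bar R}) (D : set T).
Hypothesis mD : measurable D.

Definition balanced (u : T -> R) : Prop :=
  [/\ measurable_fun D u, exists M, forall x, D x -> `|u x| <= M
    & (\int[mu]_(x in D) (u x)%:E = \int[nu]_(x in D) (u x)%:E)%E].

Lemma bounded_integrable (m : {finite_measure set T -> \bar R}) (u : T -> R)
    (M : R) : measurable_fun D u -> (forall x, D x -> `|u x| <= M) ->
  m.-integrable D (EFin \o u).
Proof.
move=> mu_ uM; apply: measurable_bounded_integrable => //.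
  by rewrite (le_lt_trans (le_measure _ _ _ (@subsetT _ D))) ?inE// ltey_eq fin_num_measure.
exists M; split; first exact: num_real.
by move=> N MN x Dx; apply: le_trans (uM _ Dx) (ltW MN).
Qed.

Lemma balanced_integrable u : balanced u ->
  mu.-integrable D (EFin \o u) /\ nu.-integrable D (EFin \o u).
Proof. by move=> [mu_ [M uM] _]; split; apply: (@bounded_integrable _ _ M). Qed.

Lemma balanced_ext (u v : T -> R) : (forall x, D x -> u x = v x) ->
  balanced u -> balanced v.
Proof.
move=> uv [mu_ [M uM] e]; split.
- by apply: eq_measurable_fun mu_ => x; rewrite inE; exact: uv.
- by exists M => x Dx; rewrite -uv//; exact: uM.
- have uvE : {in D, (fun x => (u x)%:E) =1 (fun x => (v x)%:E)}.
    by move=> x; rewrite inE => Dx; rewrite uv.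
  by rewrite -(eq_integral _ _ uvE) e; exact: eq_integral.
Qed.

Lemma balanced_bounded (u : T -> R) (M : R) :
  measurable_fun D u -> (forall x, D x -> `|u x| <= M) ->
  (\int[mu]_(x in D) (u x)%:E - \int[nu]_(x in D) (u x)%:E = 0)%E -> balanced u.
Proof.
move=> mu_ uM e0; split; [by []|by exists M|].
apply/eqP; rewrite -[eqbRHS]add0e -sube_eq ?e0//.
exact: integrable_fin_num (bounded_integrable mu mu_ uM).
Qed.

Lemma balancedD u v : balanced u -> balanced v -> balanced (u \+ v).
Proof.
move=> bu bv; have [iu ju] := balanced_integrable bu.
have [iv jv] := balanced_integrable bv.
move: bu bv => [mu_ [M uM] ue] [mv [N vN] ve]; split.
- exact: measurable_funD.
- exists (M + N) => x Dx.
  by rewrite (le_trans (ler_normD _ _))// lerD ?uM ?vN.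
- under eq_integral do rewrite EFinD.
  under [RHS]eq_integral do rewrite EFinD.
  by rewrite !integralD// ue ve.
Qed.

Lemma balancedZ (c : R) u : balanced u -> balanced (fun x => c * u x).
Proof.
move=> bu; have [iu ju] := balanced_integrable bu.
move: bu => [mu_ [M uM] ue]; split.
- exact: measurable_funM.
- by exists (`|c| * M) => x Dx; rewrite normrM ler_wpM2l ?uM.
- under eq_integral do rewrite EFinM.
  under [RHS]eq_integral do rewrite EFinM.
  by rewrite !integralZl// ue.
Qed.

Lemma balanced_sum (n : nat) (u : 'I_n -> T -> R) :
  (forall k, balanced (u k)) -> balanced (fun x => \sum_(k < n) u k x).
Proof.
elim: n u => [u _|n IH u bu].
  apply: (@balanced_ext (cst 0)) => [x _|]; first by rewrite big_ord0.
  split; [exact: measurable_cst|by exists 0 => x _; rewrite normr0|].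
  by rewrite !integral0.
apply: (balanced_ext _ (balancedD (bu ord0) (IH _ (fun k => bu (lift ord0 k))))).
by move=> x _; rewrite big_ord_recl.
Qed.

(** Dominated convergence for each of the two measures, with a constant as the
    dominating function. *)
Lemma balanced_lim (u_ : nat -> T -> R) (u : T -> R) (M : R) :
  (forall n, balanced (u_ n)) -> (forall n x, D x -> `|u_ n x| <= M) ->
  (forall x, D x -> u_ ^~ x @ \oo --> u x) -> balanced u.
Proof.
move=> bu uM cu.
have mu_ n : measurable_fun D (u_ n) by have [] := bu n.
have mu0 : measurable_fun D u by exact: (measurable_fun_cvg mu_ cu).
have key (m : {finite_measure set T -> \bar R}) :
    (fun n => \int[m]_(x in D) (u_ n x)%:E)%E @ \oo -->
    (\int[m]_(x in D) (u x)%:E)%E.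
  have [] // := @dominated_convergence _ _ _ m D mD (fun n x => (u_ n x)%:E)
    (fun x => (u x)%:E) (cst M%:E).
  - by move=> n; exact/measurable_EFinP.
  - exact/measurable_EFinP.
  - by apply: aeW => x Dx; apply: cvg_EFin; [exact: nearW|exact: cu].
  - by apply: (@bounded_integrable m (cst M) `|M|) => //; exact: measurable_cst.
  - by apply: aeW => x n Dx; rewrite lee_fin uM.
split=> //.
- exists M => x Dx; apply: (cvgr_to_le (cvg_norm (cu x Dx))).
  by apply: nearW => n; exact: uM.
- have munu : (fun n => \int[mu]_(x in D) (u_ n x)%:E)%E =
      (fun n => \int[nu]_(x in D) (u_ n x)%:E)%E.
    by apply/funext => n; case: (bu n).
  by rewrite -(cvg_lim (@ereal_hausdorff R) (key mu)) munu; apply: cvg_lim.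
Qed.


Lemma balanced_indicC (w : T -> R) (S : set T) : balanced w ->
  balanced (fun x => \1_S x * w x) -> balanced (fun x => \1_(~` S) x * w x).
Proof.
move=> bw bS; apply: balanced_ext (balancedD bw (balancedZ (-1) bS)) => x _ /=.
by rewrite mulrA mulN1r indicC indicE; case: (x \in S) => /=;
  rewrite ?oppr0 ?mul0r ?addr0 ?mul1r ?mulN1r ?subrr.
Qed.

(** The sets whose indicators, weighted by [w], are balanced form a Dynkin
    class: complements follow from linearity, disjoint unions from
    [balanced_lim] applied to the finite partial unions. *)
Lemma balanced_dynkin (G : set (set T)) (w : T -> R) :
  @measurable _ T = <<s G >> -> setI_closed G ->
  balanced w -> (forall A, G A -> balanced (fun x => \1_A x * w x)) ->
  forall B, measurable B -> balanced (fun x => \1_B x * w x).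
Proof.
move=> GE GI bw bG B; rewrite GE; move: B.
apply: (dynkin_induction GE GI).
- by apply: balanced_ext bw => x _; rewrite indicT mul1r.
- exact: bG.
- by move=> S _; exact: balanced_indicC.
move=> F _ tF bF.
pose S n := \bigcup_(k < n) F k.
have SS n : S n.+1 = S n `|` F n by rewrite /S !bigcup_mkord big_ord_recr.
have bS n : balanced (fun x => \1_(S n) x * w x).
  elim: n => [|n IH].
    apply: balanced_ext (balancedZ 0 bw) => x _.
    by rewrite /S bigcup_mkord big_ord0 indic0.
  apply: balanced_ext (balancedD IH (bF n)) => x _ /=.
  rewrite -mulrDl; congr (_ * _); rewrite SS !indicE in_setU.
  case: (boolP (x \in S n)) => [/set_mem[k kn Fkx]|_]; last by rewrite add0r.
  rewrite memNset ?addr0// => Fnx.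
  have /trivIsetP/(_ k n I I) := tF.
  rewrite lt_eqF// => /(_ isT) Fkn0.
  by have : (F k `&` F n) x by []; rewrite Fkn0.
have [_ [M wM] _] := bw.
apply: (@balanced_lim (fun n x => \1_(S n) x * w x) _ M) => //.
- move=> n x Dx; rewrite (le_trans _ (wM x Dx))// normrM indicE.
  by case: (_ \in _); rewrite ?normr1 ?mul1r ?normr0 ?mul0r.
- move=> x Dx; apply: cvgMl; rewrite indicE.
  case: (boolP (x \in _)) => [/set_mem[k _ Fkx]|xF].
    apply: cvg_near_cst; exists k.+1 => // n /= kn.
    by apply/eqP; rewrite indicE mem_set//; exists k.
  apply: cvg_near_cst; apply: nearW => n.
  apply/eqP; rewrite indicE memNset// => -[k _ Fkx].
  by move/negP: xF; apply; rewrite inE; exists k.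
Qed.

Lemma balanced_null (w : T -> R) (Q : set T) :
  (forall x, D x -> 0 < w x) -> measurable Q ->
  balanced (fun x => \1_Q x * w x) -> nu Q = 0%E -> mu (D `&` Q) = 0%E.
Proof.
move=> w0 mQ [mwQ _ e] nuQ0.
have zero : (\int[nu]_(x in D) (\1_Q x * w x)%:E = 0)%E.
  have aeQ : ae_eq nu D (fun x => (\1_Q x * w x)%:E) (cst 0%E).
    exists Q; split => // x /= /not_implyP[Dx]; apply: contra_notP => nQx.
    by rewrite indicE memNset// mul0r.
  rewrite (ae_eq_integral (cst 0%E) _ mD _ _ aeQ) ?integral0//.
  exact/measurable_EFinP.
have /ae_eq_integral_abs : (\int[mu]_(x in D) `|(\1_Q x * w x)%:E| = 0)%E.
  rewrite -zero -e; apply: eq_integral => x; rewrite inE => Dx.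
  by rewrite gee0_abs// lee_fin mulr_ge0// ltW// w0.
move=> /(_ mD) [|N [mN N0 sub]]; first exact/measurable_EFinP.
apply: (subset_measure0 _ mN _ N0); first exact: measurableI.
move=> x [Dx Qx]; apply: sub => /= /(_ Dx)/eqP.
rewrite eqe indicE mem_set// mul1r => /eqP wx0.
by have := w0 _ Dx; rewrite wx0 ltxx.
Qed.

(** When [mu] and [nu] live on disjoint sets, equality of the integrals over the
    set carrying [mu] already forces [mu] to vanish on [D]. *)
Lemma balanced_singular (w : T -> R) (P N : set T) :
  (forall x, D x -> 0 < w x) -> measurable P -> measurable N ->
  P `|` N = setT -> balanced (fun x => \1_P x * w x) ->
  mu N = 0%E -> nu P = 0%E -> mu D = 0%E.
Proof.
move=> w0 mP mN PN bP muN nuP.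
have muDP := balanced_null w0 mP bP nuP.
rewrite -(setIT D) -PN setIUr null_set_setU//; try exact: measurableI.
by apply: (subset_measure0 _ mN) muN => //; exact: measurableI.
Qed.

End balanced.

(** * Borel sets and continuous functions on row vectors *)

Section borel.
Context (R : realType) (n : nat).

Lemma compact_borel (K : set 'rV[R]_n) :
  compact K -> measurable (K : set (borel_rV R n)).
Proof.
move=> cK; rewrite -(setCK K); apply: measurableC; apply: sub_sigma_algebra.
by apply: closed_openC; apply: compact_closed => //; exact: norm_hausdorff.
Qed.

Lemma within_continuous_measurable (D : set 'rV[R]_n) (f : 'rV[R]_n -> R) :
  measurable (D : set (borel_rV R n)) -> {within D, continuous f} ->
  measurable_fun (D : set (borel_rV R n)) (f : borel_rV R n -> R).
Proof.
move=> mD /continuousP cf; apply: (measurability _ (RGenOpens.measurableE R)).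
move=> _ [_ [a [b ->] <-]].
have /cf/open_subspaceP[V oV VD] : open `]a, b[%classic by exact: interval_open.
rewrite setIC -VD; apply: measurableI => //; exact: sub_sigma_algebra.
Qed.

(** A property that holds almost everywhere holds on a dense subset of [X]: a
    relatively open set on which it fails everywhere would be null.  Continuity
    of [T] transports the density to the values of [T]. *)
Lemma full_support_approx (q : nat) (X : set 'rV[R]_n)
    (lam : {measure set (borel_rV R n) -> \bar R}) (T : 'rV[R]_n -> 'rV[R]_q)
    (P : 'rV[R]_n -> Prop) :
  measurable (X : set (borel_rV R n)) -> full_support X lam ->
  {within X, continuous T} -> {ae lam, forall x, X x -> P x} ->
  forall x, X x -> forall e, 0 < e ->
  exists y, [/\ X y, P y & `|T x - T y| < e].
Proof.
move=> mX supp /subspace_continuousP cT [N [mN N0 subN]] x Xx e e0.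
have /cvgrPdist_lt/(_ _ e0) := cT x Xx.
rewrite near_withinE nearE nbhsE => -[U [oU Ux] UT].
have XU0 : X `&` U !=set0 by exists x.
have := supp U oU XU0; apply: contraPP => noy; apply/negP; rewrite -leNgt.
have mXU : measurable (X `&` U : set (borel_rV R n)).
  by apply: measurableI => //; exact: sub_sigma_algebra.
rewrite (subset_measure0 mXU mN _ N0)//.
move=> y [Xy Uy]; apply: subN => /= /(_ Xy) Py.
by apply: noy; exists y; split=> //; exact: UT.
Qed.

(** Continuous functions which decrease to the indicator of a closed set [F]:
    [tent F k] is [1] on [F] and [0] at distance at least [1 / k] from [F]. *)
Definition tent (F : set 'rV[R]_n) (k : nat) (y : 'rV[R]_n) : R :=
  Num.max 0 (1 - k%:R * fine (edist_inf F y)).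

Lemma tent_norm_le1 F k y : `|tent F k y| <= 1.
Proof.
rewrite /tent ger0_norm ?le_max ?lexx// ge_max ler01/= gerBl mulr_ge0//.
exact/fine_ge0/edist_inf_ge0.
Qed.

Lemma edist_inf_fin_num (F : set 'rV[R]_n) y :
  F !=set0 -> edist_inf F y \is a fin_num.
Proof.
move=> [a Fa]; rewrite ge0_fin_numE ?edist_inf_ge0//.
apply: (@le_lt_trans _ _ (edist (y, a))); first by apply: ereal_inf_lbound; exists a.
rewrite -ge0_fin_numE ?edist_ge0//; apply/edist_finP; exists (`|y - a| + 1) => /=.
  by rewrite ltr_wpDl.
by rewrite -ball_normE /= ltrDl.
Qed.

Lemma tent_continuous F k : F !=set0 -> continuous (tent F k).
Proof.
move=> F0 y; apply: (@continuous_max _ _ (cst 0)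
  (fun y => 1 - k%:R * fine (edist_inf F y))); first exact: cst_continuous.
apply: continuousB; first exact: cst_continuous.
apply: continuousM; first exact: cst_continuous.
apply: (@fine_cvg _ _ (nbhs y)).
by rewrite fineK ?edist_inf_fin_num//; exact: edist_inf_continuous.
Qed.

Lemma tent_cvg F y : closed F -> F !=set0 ->
  tent F k y @[k --> \oo] --> (\1_F y : R).
Proof.
move=> cF F0; rewrite indicE; case: (boolP (y \in F)) => [/set_mem Fy|/negP Fy].
  apply: cvg_near_cst; apply: nearW => k; apply/eqP.
  by rewrite /tent edist_inf0//= mulr0 subr0 max_r.
(* A ball around y avoids F, so the distance from y to F is positive. *)
have [e e0 eF] : exists2 e, 0 < e & ball y e `<=` ~` F.
  have /nbhs_ballP[e e0 eF] : nbhs y (~` F).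
    by apply: open_nbhs_nbhs; split; [exact: closed_openC|move=> /mem_set].
  by exists e.
have ed : e <= fine (edist_inf F y).
  rewrite -lee_fin fineK ?edist_inf_fin_num//.
  apply: le_ereal_inf_tmp => _ [a Fa <-]; rewrite leNgt; apply/negP.
  by move=> /edist_lt_ball /eF; apply.
apply: cvg_near_cst; near=> k; apply/eqP; rewrite /tent max_l// subr_le0.
rewrite (@le_trans _ _ (k%:R * e))//; last by rewrite ler_wpM2l.
rewrite -ler_pdivrMr//; near: k; exact: nbhs_infty_ger.
Unshelve. all: by end_near. Qed.

End borel.

(** * The exponential family as a family of powers *)

Lemma rV_powR_expR (R : realType) (q : nat) (v s : 'rV[R]_q) :
  rV_powR (map_mx expR v) s = expR (\sum_(i < q) v 0 i * s 0 i).
Proof.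
by rewrite expR_sum; apply: eq_bigr => i _; rewrite mxE expRM.
Qed.

Lemma map_mx_expR_continuous (R : realType) (q : nat) :
  continuous (map_mx expR : 'rV[R]_q -> 'rV[R]_q).
Proof.
move=> v P [Q nbhsQ QP]; exists (fun i j => expR @^-1` Q i j).
  move=> i j; apply: continuous_expR.
  by have := nbhsQ i j; rewrite mxE.
by move=> u uQ; apply: QP => i j; rewrite mxE; exact: uQ.
Qed.

Section tilt.
Context (R : realType) (n q : nat).
Variables (Theta : set 'rV[R]_n) (eta : 'rV[R]_n -> 'rV[R]_q).
Variables (A : 'rV[R]_n -> R).
Variables (mu nu : {finite_measure set (borel_rV R n) -> \bar R}).
Hypotheses (compact_Theta : compact Theta).
Hypotheses (ceta : {within Theta, continuous eta}).
Hypotheses (cA : {within Theta, continuous A}).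

Let measurable_Theta : measurable (Theta : set (borel_rV R n)).
Proof. exact: compact_borel. Qed.

Lemma compact_within_bounded (f : 'rV[R]_n -> R) :
  {within Theta, continuous f} ->
  exists M, forall theta, Theta theta -> `|f theta| <= M.
Proof.
move=> cf; have [M [_ fM]] := compact_bounded (continuous_compact cf compact_Theta).
(* compact_bounded gives every bound strictly larger than M. *)
by exists (M + 1) => theta Htheta; apply: fM; [rewrite ltrDl|exists theta].
Qed.

(** An exponential family kernel without the factor [h x], with the sufficient
    statistic [T x] replaced by an arbitrary exponent [s]. *)
Definition tilt (s : 'rV[R]_q) (theta : 'rV[R]_n) : R :=
  rV_powR (map_mx expR (eta theta)) s * expR (- A theta).

Lemma tiltE s theta :
  tilt s theta = expR ((\sum_(i < q) eta theta 0 i * s 0 i) - A theta).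
Proof. by rewrite /tilt rV_powR_expR -expRD. Qed.

Let ceta_coord i : {within Theta, continuous (fun theta => eta theta 0 i)}.
Proof.
apply: (@within_continuous_comp _ _ _ _ eta (fun v : 'rV[R]_q => v 0 i)) => // v _.
exact: coord_continuous.
Qed.

Lemma expR_linear_continuous (a : 'I_q -> 'rV[R]_n -> R) (c : 'I_q -> R) :
  (forall i, {within Theta, continuous (a i)}) ->
  {within Theta,
    continuous (fun theta => expR ((\sum_(i < q) a i theta * c i) - A theta))}.
Proof.
move=> ca; apply: (@within_continuous_comp _ _ _ _ _ expR) => [v _|].
  exact: continuous_expR.
move=> x; apply: (@continuousB _ _ (subspace Theta)); last exact: cA.
apply: (continuous_big add_continuous) => i _ y.
by apply: cvgMl; exact: ca.
Qed.

Lemma tilt_continuous s : {within Theta, continuous (tilt s)}.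
Proof.
rewrite (_ : tilt s = fun theta =>
  expR ((\sum_(i < q) eta theta 0 i * s 0 i) - A theta)).
  by apply: expR_linear_continuous.
by apply/funext => theta; rewrite tiltE.
Qed.

(** For [s'] in the unit ball around [s], the exponent is at most
    [\sum_i |eta_i theta| (|s_i| + 1) - A theta].  That bound does not depend on
    [s'] and is continuous in [theta], so it is bounded on the compact [Theta]. *)
Lemma tilt_locally_bounded s : exists M, forall s', `|s - s'| <= 1 ->
  forall theta, Theta theta -> `|tilt s' theta| <= M.
Proof.
pose f theta :=
  expR ((\sum_(i < q) `|eta theta 0 i| * (`|s 0 i| + 1)) - A theta).
have [|M fM] := @compact_within_bounded f.
  apply: expR_linear_continuous => i.
  by apply: (@within_continuous_comp _ _ _ _ (fun theta => eta theta 0 i) Num.norm) => // v _; exact: norm_continuous.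
exists M => s' ss' theta Htheta.
rewrite (le_trans _ (le_trans (ler_norm _) (fM _ Htheta)))//.
rewrite tiltE ger0_norm ?expR_ge0// ler_expR lerD2r ler_sum// => i _.
rewrite (le_trans (ler_norm _))// normrM ler_wpM2l//.
have ssi : `|(s - s') 0 i| <= 1.
  by apply: le_trans ss'; rewrite [leRHS]mx_normrE (le_trans _ (le_bigmax _ _ (0, i))).
rewrite -lerBlDl (le_trans (lerB_dist _ _))// distrC.
by move: ssi; rewrite !mxE.
Qed.

(** [tilt s theta] is continuous in [s], and bounded uniformly in [theta] for
    [s] in a ball, so [balanced_lim] applies along any sequence of exponents
    converging to [s]. *)
Lemma balanced_tilt_closed s :
  (forall e, 0 < e -> exists s', `|s - s'| < e /\
     balanced mu nu Theta (tilt s')) ->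
  balanced mu nu Theta (tilt s).
Proof.
move=> near_s.
have inv0 k : 0 < k.+1%:R^-1 :> R by rewrite invr_gt0.
have [s_ s_P] := choice (fun k => near_s _ (inv0 k)).
have [M tiltM] := tilt_locally_bounded s.
have cs : s_ @ \oo --> s.
  apply/cvgrPdist_lt => e e0; near=> k.
  apply: lt_trans (s_P k).1 _; near: k.
  exact: near_infty_natSinv_lt (PosNum e0).
apply: (@balanced_lim _ _ _ _ _ _ measurable_Theta (fun k => tilt (s_ k)) _ M).
- by move=> k; case: (s_P k).
- move=> k; apply: tiltM; rewrite (le_trans (ltW (s_P k).1))//.
  by rewrite invf_le1// ler1n.
- move=> theta Htheta.
  rewrite tiltE; under eq_fun do rewrite tiltE.
  have cvg_coord i : s_ k 0 i @[k --> \oo] --> s 0 i.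
    exact: (cvg_comp _ _ cs (@coord_continuous _ _ _ 0 i s)).
  have cvg_exponent : (\sum_(i < q) eta theta 0 i * s_ k 0 i - A theta)
      @[k --> \oo] --> \sum_(i < q) eta theta 0 i * s 0 i - A theta.
    apply: cvgB; last exact: cvg_cst.
    by apply: (cvg_big add_continuous) => i _; exact: cvgMr.
  exact: (cvg_comp _ _ cvg_exponent (@continuous_expR _ _)).
Unshelve. all: by end_near. Qed.

Let Omega := [set map_mx expR (eta theta) | theta in Theta].
Variable S : set 'rV[R]_q.
Hypothesis S_det : determining Omega S.
Hypothesis balS : forall s, S s -> balanced mu nu Theta (tilt s).

Let w theta := expR (- A theta).

Let exp_eta theta := map_mx expR (eta theta).

Let cexp : {within Theta, continuous exp_eta}.
Proof.
apply: (@within_continuous_comp _ _ _ _ eta (map_mx expR)) => // v _.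
exact: map_mx_expR_continuous.
Qed.

Let w_bounded : exists W, forall theta, Theta theta -> `|w theta| <= W.
Proof.
apply: compact_within_bounded => x.
apply: (@continuous_comp (subspace Theta) _ _ (\- A) expR).
  by apply: continuousN; exact: cA.
exact: continuous_expR.
Qed.

(** A linear combination of powers, composed with [exp_eta] and multiplied by
    the weight, is a linear combination of functions [tilt s].  The determining
    property makes such combinations converge uniformly to [g] on [Omega]. *)
Lemma balanced_continuous (g : 'rV[R]_q -> R) : {within Omega, continuous g} ->
  balanced mu nu Theta (fun theta => g (exp_eta theta) * w theta).
Proof.
move=> cg; have inv0 k : 0 < k.+1%:R^-1 :> R by rewrite invr_gt0.
have /determiningP/(_ g cg) gS := S_det.
have /choice[p pP] : forall k : nat, exists p, power_span S p /\
    forall y, Omega y -> `|g y - p y| < k.+1%:R^-1.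
  by move=> k; have [p Sp gp] := gS _ (inv0 k); exists p.
have [M gM] : exists M, forall y, Omega y -> `|g y| <= M.
  have cO : compact Omega by exact: continuous_compact.
  have [M [_ fM]] := compact_bounded (continuous_compact cg cO).
  by exists (M + 1) => y Oy; apply: fM; [rewrite ltrDl|exists y].
have [W wW] := w_bounded.
have pg y : Omega y -> p ^~ y @ \oo --> g y.
  move=> Oy; apply/cvgrPdist_lt => e e0; near=> k.
  apply: lt_trans ((pP k).2 _ Oy) _; near: k.
  exact: near_infty_natSinv_lt (PosNum e0).
apply: (@balanced_lim _ _ _ _ _ _ measurable_Theta
  (fun k theta => p k (exp_eta theta) * w theta) _ ((M + 1) * W)).
- move=> k; have [[m [c [s [Ss ->]]]] _] := pP k.
  have bs := balanced_sum measurable_Theta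
    (fun j => balancedZ measurable_Theta (c j) (balS (Ss j))).
  apply: balanced_ext bs => theta _.
  by rewrite mulr_suml; apply: eq_bigr => j _; rewrite mulrA.
- move=> k theta Htheta; rewrite normrM ler_pM ?wW//.
  (* p k is within 1 / (k + 1), hence within 1, of g. *)
  have Oy : Omega (exp_eta theta) by exists theta.
  rewrite -(subKr (g (exp_eta theta)) (p k _)).
  rewrite (le_trans (ler_normB _ _))// lerD ?gM//.
  by rewrite (le_trans (ltW ((pP k).2 _ Oy)))// invf_le1// ler1n.
- by move=> theta Htheta; apply: cvgMl; apply: pg; exists theta.
Unshelve. all: by end_near. Qed.

Lemma balanced_weight : balanced mu nu Theta w.
Proof.
have c1 : {within Omega, continuous (cst (1 : R) : 'rV[R]_q -> R)}.
  by move=> y; exact: cst_continuous.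
by apply: balanced_ext (balanced_continuous c1) => // theta _; rewrite mul1r.
Qed.

Hypothesis eta_inj : {in Theta &, injective eta}.

Let exp_eta_inj theta theta' : Theta theta -> Theta theta' ->
  exp_eta theta = exp_eta theta' -> theta = theta'.
Proof.
move=> Ht Ht' e; apply: eta_inj; rewrite ?inE//.
apply/rowP => i; apply: expR_inj.
by move/rowP/(_ i) : e; rewrite !mxE.
Qed.

(** Injectivity of [eta] enters here: a point of [Theta] whose image lies in
    [exp_eta @` (Theta `&` K)] belongs to [K], so the indicator of [K] on [Theta]
    is a limit of continuous functions of [exp_eta theta]. *)
Lemma balanced_closed (K : set 'rV[R]_n) : closed K ->
  balanced mu nu Theta (fun theta => \1_K theta * w theta).
Proof.
move=> cK; pose F := exp_eta @` (Theta `&` K).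
have cF : closed F.
  apply: compact_closed; first exact: norm_hausdorff.
  apply: continuous_compact; last exact: compact_closedI.
  by apply: continuous_subspaceW cexp; exact: subIsetl.
have [F0|F0] := pselect (F !=set0); last first.
  apply: balanced_ext (balancedZ measurable_Theta 0 balanced_weight) => theta Htheta.
  rewrite indicE memNset// => Ktheta; apply: F0.
  by exists (exp_eta theta); exists theta.
have FK theta : Theta theta -> \1_F (exp_eta theta) = \1_K theta :> R.
  move=> Htheta; rewrite !indicE; congr (_%:R); congr nat_of_bool.
  apply/idP/idP => [/set_mem[t [Ht Kt] /exp_eta_inj <-//]|/set_mem Ktheta].
    exact/mem_set.
  by apply/mem_set; exists theta.
have [W wW] := w_bounded.
apply: (@balanced_lim _ _ _ _ _ _ measurable_Theta
  (fun k theta => tent F k (exp_eta theta) * w theta)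
  (fun theta => \1_K theta * w theta) (1 * W)).
- move=> k; apply: balanced_continuous.
  by apply: continuous_subspaceT; exact: tent_continuous.
- by move=> k theta Htheta; rewrite normrM ler_pM ?wW ?tent_norm_le1.
- by move=> theta Htheta; apply: cvgMl; rewrite -FK//; exact: tent_cvg.
Qed.

Lemma balanced_borel (B : set (borel_rV R n)) : measurable B ->
  balanced mu nu Theta (fun theta => \1_B theta * w theta).
Proof.
apply: (@balanced_dynkin _ _ _ mu nu _ measurable_Theta (@open 'rV[R]_n)) => //.
- exact: openI.
- exact: balanced_weight.
move=> U oU; have bC := balanced_closed (open_closedC oU).
rewrite -(setCK U).
exact: balanced_indicC balanced_weight bC.
Qed.

End tilt.

(** * Injectivity of the mixture operator *)

Theorem proposition5 (R : realType) (d1 d2 q : nat)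
    (X : set 'rV[R]_d1) (lam : {measure set (borel_rV R d1) -> \bar R})
    (Theta : set 'rV[R]_d2)
    (f : 'rV[R]_d1 -> 'rV[R]_d2 -> R)
    (h : 'rV[R]_d1 -> R) (T : 'rV[R]_d1 -> 'rV[R]_q)
    (eta : 'rV[R]_d2 -> 'rV[R]_q) (A : 'rV[R]_d2 -> R)
    (mX : measurable (X : set (borel_rV R d1)))
    (lam_sfin : sigma_finite (X : set (borel_rV R d1)) lam)
    (lam_supp : full_support X lam)
    (HTheta : parameter_space Theta)
    (f_kernel : is_kernel X lam Theta f)
    (f_exp : exponential_form X Theta f h T eta A)
    (mh : measurable_fun (X : set (borel_rV R d1)) (h : borel_rV R d1 -> R))
    (h_gt0 : {ae lam, forall x, X x -> 0 < h x})
    (cA : {within Theta, continuous A})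
    (cT : {within X, continuous T})
    (eta_inj : {in Theta &, injective eta})
    (ceta : {within Theta, continuous eta})
    (T_det : determining
       [set map_mx expR (eta theta) | theta in Theta] (T @` X)) :
  forall G : {charge set (borel_rV R d2) -> \bar R},
    signed_measure_on Theta G ->
    {ae lam, forall x, X x -> mixture Theta f G x = 0%E} ->
    forall B : set (borel_rV R d2), measurable B -> G B = 0%E.
Proof.
move=> G GTheta AG0.
have [P [N PN]] := Hahn_decomposition G.
have [compact_Theta _ _] := HTheta.
have mTheta := compact_borel compact_Theta.
pose mu : {finite_measure set (borel_rV R d2) -> \bar R} := jordan_pos PN.
pose nu : {finite_measure set (borel_rV R d2) -> \bar R} := jordan_neg PN.
have bal_good x : X x -> 0 < h x -> mixture Theta f G x = 0%E ->
    balanced mu nu Theta (tilt eta A (T x)).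
  move=> Xx hx0; rewrite /mixture (charge_integralE PN) => mix0.
  have fE theta : Theta theta -> h x * tilt eta A (T x) theta = f x theta.
    by move=> Htheta; rewrite f_exp// tiltE.
  have ctilt := tilt_continuous ceta cA (s := T x).
  have [M tM] := compact_within_bounded compact_Theta ctilt.
  have mtilt := within_continuous_measurable mTheta ctilt.
  have bf : balanced mu nu Theta (fun theta => h x * tilt eta A (T x) theta).
    apply: (@balanced_bounded _ _ _ _ _ _ mTheta _ (`|h x| * M)).
    - exact: measurable_funM.
    - by move=> theta Ht; rewrite normrM ler_wpM2l ?tM.
    - have intE (m : {finite_measure set (borel_rV R d2) -> \bar R}) :
          (\int[m]_(theta in Theta) (h x * tilt eta A (T x) theta)%:E =
           \int[m]_(theta in Theta) (f x theta)%:E)%E.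
        by apply: eq_integral => theta; rewrite inE => Ht; rewrite fE.
      by rewrite !intE.
  apply: balanced_ext (balancedZ mTheta (h x)^-1 bf) => theta _.
  by rewrite mulrA mulVf ?mul1r// gt_eqF.
(* The exponents reached from points where the mixture vanishes and h is
   positive are dense in the range of T. *)
have bal_range s : (T @` X) s -> balanced mu nu Theta (tilt eta A s).
  move=> [x Xx <-]; apply: balanced_tilt_closed => // e e0.
  have good : {ae lam, forall y, X y -> 0 < h y /\ mixture Theta f G y = 0%E}.
    apply: (@filterS2 _ _ (ae_filter_ringOfSetsType lam)) h_gt0 AG0 => y hy gy Xy.
    by split; [exact: hy|exact: gy].
  have [y [Xy [hy gy] Txy]] := full_support_approx mX lam_supp cT good Xx e0.
  by exists (T y); split => //; exact: bal_good.
have w0 theta : Theta theta -> 0 < expR (- A theta) by rewrite expR_gt0.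
have bal_borel := balanced_borel compact_Theta ceta cA T_det bal_range eta_inj.
have [[mP _] [mN _] PNT PN0] := PN.
have muN0 : mu N = 0%E.
  by rewrite [LHS]jordan_posE cjordan_posE /crestr0 mem_set// /crestr setIC PN0 charge0.
have nuP0 : nu P = 0%E.
  by rewrite [LHS]jordan_negE cjordan_negE /crestr0 mem_set// /crestr PN0 charge0 oppe0.
have muTheta : mu Theta = 0%E.
  exact: (balanced_singular mTheta w0 mP mN PNT (bal_borel _ mP)).
have nuTheta : nu Theta = 0%E.
  rewrite setUC in PNT.
  have [mw bw e] := bal_borel _ mN.
  by apply: (balanced_singular (nu := mu) mTheta w0 mN mP PNT).
move=> B mB.
have mBT : measurable (B `&` Theta) by exact: measurableI.
have mBD : measurable (B `\` Theta) by exact: measurableD.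
rewrite -(setDUK (@subIsetl _ B Theta)) setDIr setDv set0U chargeU//; last first.
  by rewrite setDE setIACA setICr setI0.
rewrite (GTheta _ mBD) ?adde0; last by rewrite setDE -setIA setICl setI0.
have muB : mu (B `&` Theta) = 0%E by exact: (subset_measure0 mBT mTheta).
have nuB : nu (B `&` Theta) = 0%E by exact: (subset_measure0 mBT mTheta).
rewrite (jordan_decomp PN mBT) /cadd/= cscaleN1.
by rewrite -[LHS]/(mu (B `&` Theta) - nu (B `&` Theta))%E muB nuB sube0.
Qed.
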